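(* Let $(\mathcal A_n)_{n\in\mathbb N}$ be a sequence of unital Banach algebras, and let $\mathcal U$ be a non-principal ultrafilter on $\mathbb N$. Then the ultraproduct $(\mathcal A_n)_{\mathcal U}$ is properly infinite if and only if there is $K>0$ such that $\{n\in\mathbb N : C_{\mathrm{PI}}(\mathcal A_n)\le K\}\in\mathcal U$.
   Context: Banach algebras are complex and have a contractive product $\|ab\|\le\|a\|\|b\|$; a unital Banach algebra has unit $1$ with $\|1\|=1$. For a sequence $(\mathcal A_n)$ of Banach algebras, $\ell^\infty(\mathcal A_n)$ is the Banach algebra of all bounded sequences $(a_n)$ with $a_n\in\mathcal A_n$, with pointwise operations and the supremum norm; $c_{\mathcal U}(\mathcal A_n)$ is the closed two-sided ideal of those $(a_n)$ with $\lim_{n\to\mathcal U}\|a_n\|=0$; the ultraproduct is $(\mathcal A_n)_{\mathcal U}=\ell^\infty(\mathcal A_n)/c_{\mathcal U}(\mathcal A_n)$ with the quotient norm. Two idempotents $p,q$ in an algebra $\mathcal A$ are equivalent, $p\sim q$, if there are $a,b\in\mathcal A$ with $p=ab$ and $q=ba$; they are orthogonal if $pq=0=qp$. A unital algebra $\mathcal A$ is properly infinite if there are orthogonal idempotents $p,q\in\mathcal A$ with $p\sim 1$ and $q\sim 1$. For a unital Banach algebra $\mathcal A$, $$C_{\mathrm{PI}}(\mathcal A)=\inf\{\|a\|\|b\|\|c\|\|d\| : a,b,c,d\in\mathcal A,\ ab=1=cd,\ ad=0=cb\},$$ with $\inf\emptyset=+\infty$. *)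

(* Defs.v *)
From HB Require Import structures.
From mathcomp Require Import all_boot all_order all_algebra.
From mathcomp Require Import generic_quotient ring_quotient.
From mathcomp Require Import all_classical all_reals all_analysis.
From mathcomp Require Import complex.
From mathcomp Require Import lra.

Set Implicit Arguments.
Unset Strict Implicit.
Unset Printing Implicit Defensive.

Import Order.TTheory GRing.Theory Num.Theory.
Import numFieldNormedType.Exports.

Local Open Scope classical_set_scope.
Local Open Scope ring_scope.
Local Open Scope complex_scope.
Local Open Scope quotient_scope.

(* The norm is a real-valued operation of this mixin because Hierarchy Builder
   rejects any common extension of [GRing.Algebra] and [Num.NormedZmodule]: it
   would compete with [Num.NumDomain] as a join of rings and normed groups. *)
HB.mixin Record isUnitalBanachAlgebra (R : realType) A
    of GRing.Algebra R[i] A := {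
  bnorm : A -> R ;
  bnorm_eq0 : forall x, bnorm x = 0 -> x = 0 ;
  bnormD : forall x y, bnorm (x + y) <= bnorm x + bnorm y ;
  bnormZ : forall (k : R[i]) x, (bnorm (k *: x))%:C = `|k| * (bnorm x)%:C ;
  bnormM : forall x y, bnorm (x * y) <= bnorm x * bnorm y ;
  bnorm1 : bnorm 1 = 1 ;
  bcomplete : forall u : nat -> A,
    (forall e : R, 0 < e -> exists N, forall m n,
        (N <= m)%N -> (N <= n)%N -> bnorm (u m - u n) < e) ->
    exists l, forall e : R, 0 < e -> exists N, forall n,
        (N <= n)%N -> bnorm (u n - l) < e
}.

#[short(type="unitalBanachAlgType")]
HB.structure Definition UnitalBanachAlgebra (R : realType) :=
  { A of GRing.Algebra R[i] A & isUnitalBanachAlgebra R A }.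

Section NormTheory.
Variables (R : realType) (A : unitalBanachAlgType R).
Implicit Types x y : A.

Lemma bnorm0 : bnorm (0 : A) = 0.
Proof.
by apply: (@complexI R); rewrite -(scale0r (0 : A)) bnormZ normr0 mul0r.
Qed.

Lemma bnormN x : bnorm (- x) = bnorm x.
Proof.
by apply: (@complexI R); rewrite -scaleN1r bnormZ normrN normr1 mul1r.
Qed.

Lemma bnorm_ge0 x : 0 <= bnorm x.
Proof. by have := bnormD x (- x); rewrite subrr bnorm0 bnormN; lra. Qed.

Lemma bnormBC x y : bnorm (x - y) = bnorm (y - x).
Proof. by rewrite -bnormN opprB. Qed.

Lemma bnormB_tri x y z : bnorm (x - z) <= bnorm (x - y) + bnorm (y - z).
Proof. by rewrite (le_trans _ (bnormD _ _))// addrA subrK. Qed.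

Lemma bnormZ_Re (k : R[i]) x :
  bnorm (k *: x) = complex.Re `|k| * bnorm x.
Proof.
by apply: (@complexI R); rewrite bnormZ -{1}(RRe_real (normr_real k)) -rmorphM.
Qed.

End NormTheory.

Section Linfty.
Variables (R : realType) (A : nat -> unitalBanachAlgType R).

Record linfty := Linfty {
  linfty_seq :> forall n, A n ;
  linfty_bounded : exists M : R, forall n, bnorm (linfty_seq n) <= M }.

HB.instance Definition _ := gen_eqMixin linfty.
HB.instance Definition _ := gen_choiceMixin linfty.

Lemma linfty_eq (a b : linfty) : (forall n, a n = b n) -> a = b.
Proof.
case: a b => [a a_bd] [b b_bd] /= ab.
have {}ab : a = b by apply: functional_extensionality_dep.
by subst b; congr Linfty; apply: Prop_irrelevance.
Qed.

Fact linfty_zero_bounded : exists M : R, forall n, bnorm (0 : A n) <= M.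
Proof. by exists 0 => n; rewrite bnorm0. Qed.

Fact linfty_one_bounded : exists M : R, forall n, bnorm (1 : A n) <= M.
Proof. by exists 1 => n; rewrite bnorm1. Qed.

Fact linfty_opp_bounded (a : linfty) :
  exists M : R, forall n, bnorm (- a n) <= M.
Proof.
by case: (linfty_bounded a) => M aM; exists M => n; rewrite bnormN.
Qed.

Fact linfty_add_bounded (a b : linfty) :
  exists M : R, forall n, bnorm (a n + b n) <= M.
Proof.
case: (linfty_bounded a) (linfty_bounded b) => [M aM] [M' bM].
by exists (M + M') => n; rewrite (le_trans (bnormD _ _))// lerD.
Qed.

Fact linfty_mul_bounded (a b : linfty) :
  exists M : R, forall n, bnorm (a n * b n) <= M.
Proof.
case: (linfty_bounded a) (linfty_bounded b) => [M aM] [M' bM].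
by exists (M * M') => n; rewrite (le_trans (bnormM _ _))// ler_pM ?bnorm_ge0.
Qed.

Fact linfty_scale_bounded (k : R[i]) (a : linfty) :
  exists M : R, forall n, bnorm (k *: a n) <= M.
Proof.
case: (linfty_bounded a) => M aM; exists (complex.Re `|k| * M) => n.
by rewrite bnormZ_Re ler_wpM2l// -ler0c RRe_real ?normr_real.
Qed.

Definition linfty_zero := Linfty linfty_zero_bounded.
Definition linfty_one := Linfty linfty_one_bounded.
Definition linfty_opp a := Linfty (linfty_opp_bounded a).
Definition linfty_add a b := Linfty (linfty_add_bounded a b).
Definition linfty_mul a b := Linfty (linfty_mul_bounded a b).
Definition linfty_scale k a := Linfty (linfty_scale_bounded k a).

Fact linfty_addA : associative linfty_add.
Proof. by move=> a b c; apply: linfty_eq => n /=; rewrite addrA. Qed.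
Fact linfty_addC : commutative linfty_add.
Proof. by move=> a b; apply: linfty_eq => n /=; rewrite addrC. Qed.
Fact linfty_add0 : left_id linfty_zero linfty_add.
Proof. by move=> a; apply: linfty_eq => n /=; rewrite add0r. Qed.
Fact linfty_addN : left_inverse linfty_zero linfty_opp linfty_add.
Proof. by move=> a; apply: linfty_eq => n /=; rewrite addNr. Qed.

HB.instance Definition _ := GRing.isZmodule.Build linfty
  linfty_addA linfty_addC linfty_add0 linfty_addN.

Fact linfty_mulA : associative linfty_mul.
Proof. by move=> a b c; apply: linfty_eq => n /=; rewrite mulrA. Qed.
Fact linfty_mul1l : left_id linfty_one linfty_mul.
Proof. by move=> a; apply: linfty_eq => n /=; rewrite mul1r. Qed.
Fact linfty_mul1r : right_id linfty_one linfty_mul.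
Proof. by move=> a; apply: linfty_eq => n /=; rewrite mulr1. Qed.
Fact linfty_mulDl : left_distributive linfty_mul +%R.
Proof. by move=> a b c; apply: linfty_eq => n /=; rewrite mulrDl. Qed.
Fact linfty_mulDr : right_distributive linfty_mul +%R.
Proof. by move=> a b c; apply: linfty_eq => n /=; rewrite mulrDr. Qed.
Fact linfty_one_neq0 : linfty_one != 0.
Proof.
apply/eqP => /(congr1 (fun a : linfty => a 0%N)) /= /eqP.
by rewrite oner_eq0.
Qed.

HB.instance Definition _ := GRing.Zmodule_isNzRing.Build linfty
  linfty_mulA linfty_mul1l linfty_mul1r linfty_mulDl linfty_mulDr
  linfty_one_neq0.

Fact linfty_scaleA (k l : R[i]) (a : linfty) :
  linfty_scale k (linfty_scale l a) = linfty_scale (k * l) a.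
Proof. by apply: linfty_eq => n /=; rewrite scalerA. Qed.
Fact linfty_scale1 : left_id 1 linfty_scale.
Proof. by move=> a; apply: linfty_eq => n /=; rewrite scale1r. Qed.
Fact linfty_scaleDr : right_distributive linfty_scale +%R.
Proof. by move=> k a b; apply: linfty_eq => n /=; rewrite scalerDr. Qed.
Fact linfty_scaleDl (a : linfty) : {morph linfty_scale^~ a : k l / k + l}.
Proof. by move=> k l; apply: linfty_eq => n /=; rewrite scalerDl. Qed.

HB.instance Definition _ := GRing.Zmodule_isLmodule.Build R[i] linfty
  linfty_scaleA linfty_scale1 linfty_scaleDr linfty_scaleDl.

Fact linfty_scaleAl (k : R[i]) (a b : linfty) : k *: (a * b) = k *: a * b.
Proof. by apply: linfty_eq => n /=; rewrite -scalerAl. Qed.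
Fact linfty_scaleAr (k : R[i]) (a b : linfty) : k *: (a * b) = a * (k *: b).
Proof. by apply: linfty_eq => n /=; rewrite -scalerAr. Qed.

HB.instance Definition _ :=
  GRing.Lmodule_isLalgebra.Build R[i] linfty linfty_scaleAl.
HB.instance Definition _ :=
  GRing.Lalgebra_isAlgebra.Build R[i] linfty linfty_scaleAr.

Definition linfty_norm (a : linfty) : R :=
  sup [set bnorm (a n) | n in [set: nat]].

Lemma linfty_norm_ub (a : linfty) n : bnorm (a n) <= linfty_norm a.
Proof.
apply: ub_le_sup; last by exists n.
by case: (linfty_bounded a) => M aM; exists M => _ [m _ <-].
Qed.

Lemma linfty_norm_le (a : linfty) (M : R) :
  (forall n, bnorm (a n) <= M) -> linfty_norm a <= M.
Proof.
move=> aM; apply: ge_sup; first by exists (bnorm (a 0%N)), 0%N.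
by move=> _ [n _ <-].
Qed.

Fact linfty_norm_eq0 a : linfty_norm a = 0 -> a = 0.
Proof.
move=> a0; apply: linfty_eq => n; apply: bnorm_eq0; apply/le_anti.
by rewrite bnorm_ge0 -a0 linfty_norm_ub.
Qed.

Fact linfty_normD a b : linfty_norm (a + b) <= linfty_norm a + linfty_norm b.
Proof.
apply: linfty_norm_le => n.
by rewrite (le_trans (bnormD _ _))// lerD// linfty_norm_ub.
Qed.

Fact linfty_normM a b : linfty_norm (a * b) <= linfty_norm a * linfty_norm b.
Proof.
apply: linfty_norm_le => n.
by rewrite (le_trans (bnormM _ _))// ler_pM ?bnorm_ge0// linfty_norm_ub.
Qed.

Fact linfty_norm1 : linfty_norm 1 = 1.
Proof.
apply/le_anti/andP; split.
  by apply: linfty_norm_le => n; rewrite /= bnorm1.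
by have := linfty_norm_ub 1 0; rewrite /= bnorm1.
Qed.

Fact linfty_normZ (k : R[i]) (a : linfty) :
  (linfty_norm (k *: a))%:C = `|k| * (linfty_norm a)%:C.
Proof.
have k_real : `|k| = (complex.Re `|k|)%:C by rewrite RRe_real ?normr_real.
have {k_real} [r r0 kr] : exists2 r : R, 0 <= r & `|k| = r%:C.
  by exists (complex.Re `|k|); rewrite // -ler0c -k_real.
have ka n : bnorm (k *: a n) = r * bnorm (a n) by rewrite bnormZ_Re kr.
rewrite kr -rmorphM; congr (_%:C); apply/le_anti/andP; split.
  apply: linfty_norm_le => n /=.
  by rewrite ka ler_wpM2l// linfty_norm_ub.
have [->|r_neq0] := eqVneq r 0.
  by rewrite mul0r (le_trans (bnorm_ge0 _) (linfty_norm_ub _ 0%N)).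
have rp : 0 < r by rewrite lt_neqAle eq_sym r_neq0.
rewrite -ler_pdivlMl//; apply: linfty_norm_le => n.
by rewrite ler_pdivlMl// -ka (linfty_norm_ub (k *: a)).
Qed.

Fact linfty_complete (u : nat -> linfty) :
  (forall e : R, 0 < e -> exists N, forall m n,
      (N <= m)%N -> (N <= n)%N -> linfty_norm (u m - u n) < e) ->
  exists l, forall e : R, 0 < e -> exists N, forall n,
      (N <= n)%N -> linfty_norm (u n - l) < e.
Proof.
move=> uC.
have lim j : {l : A j | forall e : R, 0 < e ->
    exists N, forall n, (N <= n)%N -> bnorm (u n j - l) < e}.
  apply: cid; apply: (bcomplete (fun n => u n j)) => e e0.
  have [N NP] := uC e e0; exists N => m n Nm Nn.
  exact: le_lt_trans (linfty_norm_ub (u m - u n) j) (NP _ _ Nm Nn).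
pose l0 j := sval (lim j); have l0P j := svalP (lim j).
have close e : 0 < e -> exists N, forall n, (N <= n)%N ->
    forall j, bnorm (u n j - l0 j) <= e.
  move=> e0; have [N NP] := uC _ e0; exists N => n Nn j.
  apply/ler_addgt0Pr => d d0; have [N' N'P] := l0P j _ d0.
  rewrite (le_trans (bnormB_tri _ (u (maxn N N') j) _))// lerD//.
    apply: le_trans (linfty_norm_ub (u n - u (maxn N N')) j) _.
    by rewrite ltW// NP// leq_maxl.
  by rewrite ltW// N'P// leq_maxr.
have l0_bd : exists M : R, forall n, bnorm (l0 n) <= M.
  have [N NP] := close 1 ltr01; exists (linfty_norm (u N) + 1) => j.
  rewrite -(bnormN (l0 j)) -[- l0 j](addKr (u N j)).
  apply: le_trans (bnormD _ _) _.
  by rewrite bnormN lerD ?linfty_norm_ub// NP.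
exists (Linfty l0_bd) => e e0.
have [N NP] := close (e / 2) (divr_gt0 e0 (ltr0Sn _ _)).
exists N => n Nn; apply: le_lt_trans (_ : e / 2 < e); last by lra.
by apply: linfty_norm_le => j; exact: NP.
Qed.

HB.instance Definition _ := isUnitalBanachAlgebra.Build R linfty
  linfty_norm_eq0 linfty_normD linfty_normZ linfty_normM linfty_norm1
  linfty_complete.

End Linfty.

Record closedIdeal (R : realType) (B : unitalBanachAlgType R) := ClosedIdeal {
  cideal : set B ;
  cideal0 : cideal 0 ;
  cidealB : forall x y, cideal x -> cideal y -> cideal (x - y) ;
  cidealMl : forall a x, cideal x -> cideal (a * x) ;
  cidealMr : forall a x, cideal x -> cideal (x * a) ;
  cideal_proper : ~ cideal 1 ;
  cideal_closed : forall x, (forall e : R, 0 < e ->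
    exists2 y, cideal y & bnorm (x - y) < e) -> cideal x
}.

Section Quotient.
Variables (R : realType) (B : unitalBanachAlgType R) (I : closedIdeal B).

Definition cideal_mem : {pred B} := fun x => `[< cideal I x >].

Fact cideal_mem_zmod_closed : zmod_closed cideal_mem.
Proof.
split; first by apply/asboolP; exact: cideal0.
by move=> x y /asboolP Ix /asboolP Iy; apply/asboolP; exact: cidealB.
Qed.

HB.instance Definition _ :=
  GRing.isZmodClosed.Build B cideal_mem cideal_mem_zmod_closed.

(* The library has ring quotients only for commutative rings: [bquot] is its
   quotient of additive groups, and product, scaling and norm are added. *)
Definition bquot := Quotient.quot (cideal_mem : zmodClosed B).
HB.instance Definition _ := GRing.Zmodule.on bquot.
HB.instance Definition _ := EqQuotient.on bquot.

Definition bpi (x : B) : bquot := \pi_bquot x.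

Lemma bpi_surj (q : bquot) : exists x, bpi x = q.
Proof. by exists (repr q); rewrite /bpi reprK. Qed.

Lemma bpi_eq (x y : B) : bpi x = bpi y <-> cideal I (x - y).
Proof.
split=> [/eqP|Ixy]; first by rewrite -Quotient.idealrBE => /asboolP.
by apply/eqP; rewrite -Quotient.idealrBE; apply/asboolP.
Qed.

Lemma bpi0 : bpi 0 = 0.
Proof. by rewrite /bpi piE. Qed.

Lemma bpiD x y : bpi (x + y) = bpi x + bpi y.
Proof. by rewrite /bpi !piE. Qed.

Lemma bpiN x : bpi (- x) = - bpi x.
Proof. by rewrite /bpi !piE. Qed.

Definition bquot_one : bquot := bpi 1.
Definition bquot_mul (p q : bquot) : bquot := bpi (repr p * repr q).
Definition bquot_scale (k : R[i]) (q : bquot) : bquot := bpi (k *: repr q).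

Lemma cideal_repr x : cideal I (repr (bpi x) - x).
Proof. by apply/bpi_eq; rewrite /bpi reprK. Qed.

Fact bpi_mul x y : bquot_mul (bpi x) (bpi y) = bpi (x * y).
Proof.
apply/bpi_eq; set x' := repr _; set y' := repr _.
have -> : x' * y' - x * y = (x' - x) * y' - x * (y - y').
  by rewrite mulrBl mulrBr opprB addrA subrK.
apply: cidealB; first exact/cidealMr/cideal_repr.
apply: cidealMl; rewrite -opprB -sub0r; apply: cidealB; first exact: cideal0.
exact: cideal_repr.
Qed.

Fact bpi_scale k x : bquot_scale k (bpi x) = bpi (k *: x).
Proof.
apply/bpi_eq; rewrite -scalerBr -[_ - _]mul1r scalerAl.
exact/cidealMl/cideal_repr.
Qed.

Fact bquot_mulA : associative bquot_mul.
Proof.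
move=> p q r; have [x <-] := bpi_surj p; have [y <-] := bpi_surj q.
by have [z <-] := bpi_surj r; rewrite !bpi_mul mulrA.
Qed.
Fact bquot_mul1l : left_id bquot_one bquot_mul.
Proof. by move=> p; have [x <-] := bpi_surj p; rewrite bpi_mul mul1r. Qed.
Fact bquot_mul1r : right_id bquot_one bquot_mul.
Proof. by move=> p; have [x <-] := bpi_surj p; rewrite bpi_mul mulr1. Qed.
Fact bquot_mulDl : left_distributive bquot_mul +%R.
Proof.
move=> p q r; have [x <-] := bpi_surj p; have [y <-] := bpi_surj q.
by have [z <-] := bpi_surj r; rewrite -bpiD !bpi_mul -bpiD mulrDl.
Qed.
Fact bquot_mulDr : right_distributive bquot_mul +%R.
Proof.
move=> p q r; have [x <-] := bpi_surj p; have [y <-] := bpi_surj q.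
by have [z <-] := bpi_surj r; rewrite -bpiD !bpi_mul -bpiD mulrDr.
Qed.
Fact bquot_one_neq0 : bquot_one != 0.
Proof.
apply/eqP; rewrite -bpi0 => /bpi_eq; rewrite subr0.
exact: cideal_proper.
Qed.

HB.instance Definition _ := GRing.Zmodule_isNzRing.Build bquot
  bquot_mulA bquot_mul1l bquot_mul1r bquot_mulDl bquot_mulDr bquot_one_neq0.

Fact bquot_scaleA (k l : R[i]) (q : bquot) :
  bquot_scale k (bquot_scale l q) = bquot_scale (k * l) q.
Proof. by have [x <-] := bpi_surj q; rewrite !bpi_scale scalerA. Qed.
Fact bquot_scale1 : left_id 1 bquot_scale.
Proof. by move=> q; have [x <-] := bpi_surj q; rewrite bpi_scale scale1r. Qed.
Fact bquot_scaleDr : right_distributive bquot_scale +%R.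
Proof.
move=> k p q; have [x <-] := bpi_surj p; have [y <-] := bpi_surj q.
by rewrite -bpiD !bpi_scale -bpiD scalerDr.
Qed.
Fact bquot_scaleDl (q : bquot) : {morph bquot_scale^~ q : k l / k + l}.
Proof.
by move=> k l; have [x <-] := bpi_surj q; rewrite !bpi_scale -bpiD scalerDl.
Qed.

HB.instance Definition _ := GRing.Zmodule_isLmodule.Build R[i] bquot
  bquot_scaleA bquot_scale1 bquot_scaleDr bquot_scaleDl.

Lemma bpiM x y : bpi (x * y) = bpi x * bpi y.
Proof. by rewrite -bpi_mul. Qed.
Lemma bpi1 : bpi 1 = 1.
Proof. by []. Qed.
Lemma bpiZ k x : bpi (k *: x) = k *: bpi x.
Proof. by rewrite -bpi_scale. Qed.

Fact bquot_scaleAl (k : R[i]) (p q : bquot) : k *: (p * q) = k *: p * q.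
Proof.
have [x <-] := bpi_surj p; have [y <-] := bpi_surj q.
by rewrite -bpiM -!bpiZ -bpiM scalerAl.
Qed.
Fact bquot_scaleAr (k : R[i]) (p q : bquot) : k *: (p * q) = p * (k *: q).
Proof.
have [x <-] := bpi_surj p; have [y <-] := bpi_surj q.
by rewrite -bpiM -!bpiZ -bpiM scalerAr.
Qed.

HB.instance Definition _ :=
  GRing.Lmodule_isLalgebra.Build R[i] bquot bquot_scaleAl.
HB.instance Definition _ :=
  GRing.Lalgebra_isAlgebra.Build R[i] bquot bquot_scaleAr.

Definition bquot_norm (q : bquot) : R :=
  inf [set bnorm x | x in [set x | bpi x = q]].

Lemma bquot_norm_ge0 q : 0 <= bquot_norm q.
Proof.
apply: lb_le_inf; last by move=> _ [x _ <-]; exact: bnorm_ge0.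
by have [x xq] := bpi_surj q; exists (bnorm x), x.
Qed.

Lemma bquot_norm_le x : bquot_norm (bpi x) <= bnorm x.
Proof.
apply: ge_inf; last by exists x.
by exists 0 => _ [y _ <-]; exact: bnorm_ge0.
Qed.

Lemma bquot_norm_lift (q : bquot) (e : R) :
  bquot_norm q < e -> exists2 x, bpi x = q & bnorm x < e.
Proof.
move=> qe; have q0 : [set bnorm x | x in [set x | bpi x = q]] !=set0.
  by have [x xq] := bpi_surj q; exists (bnorm x), x.
by have [_ [x /= xq <-] xe] := inf_lt q0 qe; exists x.
Qed.

Fact bquot_norm_eq0 q : bquot_norm q = 0 -> q = 0.
Proof.
have [x <-] := bpi_surj q => x0; rewrite -bpi0; apply/bpi_eq; rewrite subr0.
apply: cideal_closed => e e0.
have [y yx ye] : exists2 y, bpi y = bpi x & bnorm y < e.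
  by apply: bquot_norm_lift; rewrite x0.
exists (x - y); first by apply/bpi_eq.
by rewrite opprB addrC subrK.
Qed.

Fact bquot_normD p q : bquot_norm (p + q) <= bquot_norm p + bquot_norm q.
Proof.
apply/ler_addgt0Pr => e e0.
have [x <- xe] : exists2 x, bpi x = p & bnorm x < bquot_norm p + e / 2.
  by apply: bquot_norm_lift; lra.
have [y <- ye] : exists2 y, bpi y = q & bnorm y < bquot_norm q + e / 2.
  by apply: bquot_norm_lift; lra.
rewrite -bpiD.
have := bquot_norm_le (x + y); have := bnormD x y.
by move: xe ye; lra.
Qed.

Fact bquot_normM p q : bquot_norm (p * q) <= bquot_norm p * bquot_norm q.
Proof.
have p0 := bquot_norm_ge0 p; have q0 := bquot_norm_ge0 q.
suff main e : 0 < e ->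
    bquot_norm (p * q) <= (bquot_norm p + e) * (bquot_norm q + e).
  apply/ler_addgt0Pr => d d0.
  set a := bquot_norm p in p0 main *; set b := bquot_norm q in q0 main *.
  have s0 : 0 < a + b + 1 by lra.
  pose e := Num.min 1 (d / (a + b + 1)).
  have e0 : 0 < e by rewrite lt_min ltr01 divr_gt0.
  have e1 : e <= 1 by rewrite ge_min lexx.
  have ed : e * (a + b + 1) <= d.
    by rewrite -ler_pdivlMr// ge_min lexx orbT.
  apply: le_trans (main e e0) _.
  have : e * e <= e by rewrite ger_pMr.
  by move: ed; rewrite !mulrDr !mulrDl mulr1 (mulrC a e); lra.
move=> e0.
have [x <- xe] : exists2 x, bpi x = p & bnorm x < bquot_norm p + e.
  by apply: bquot_norm_lift; lra.
have [y <- ye] : exists2 y, bpi y = q & bnorm y < bquot_norm q + e.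
  by apply: bquot_norm_lift; lra.
rewrite -bpiM (le_trans (bquot_norm_le _))// (le_trans (bnormM _ _))//.
by rewrite ler_pM ?bnorm_ge0// ltW.
Qed.

Fact bquot_norm1 : bquot_norm 1 = 1.
Proof.
apply/le_anti/andP; split.
  by rewrite -bpi1 (le_trans (bquot_norm_le _))// bnorm1.
have := bquot_normM 1 1; rewrite mulr1.
have [/bquot_norm_eq0 /eqP|n0] := eqVneq (bquot_norm 1) 0.
  by rewrite oner_eq0.
by rewrite ler_pMr// lt_neqAle eq_sym n0 bquot_norm_ge0.
Qed.

Lemma bquot_normZ_le (k : R[i]) (q : bquot) :
  bquot_norm (k *: q) <= complex.Re `|k| * bquot_norm q.
Proof.
have r0 : 0 <= complex.Re `|k| by rewrite -ler0c RRe_real ?normr_real.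
set r := complex.Re _ in r0 *.
apply/ler_addgt0Pr => e e0.
have s0 : 0 < r + 1 by lra.
have [x <- xe] : exists2 x, bpi x = q & bnorm x < bquot_norm q + e / (r + 1).
  by apply: bquot_norm_lift; rewrite ltrDl divr_gt0.
rewrite -bpiZ (le_trans (bquot_norm_le _))// bnormZ_Re -/r.
apply: le_trans (ler_wpM2l r0 (ltW xe)) _.
rewrite mulrDr lerD2l mulrCA -[leRHS]mulr1.
by rewrite ler_pM2l// ler_pdivrMr// mul1r lerDl.
Qed.

Fact bquot_normZ (k : R[i]) (q : bquot) :
  (bquot_norm (k *: q))%:C = `|k| * (bquot_norm q)%:C.
Proof.
have kE (c : R[i]) : `|c| = (complex.Re `|c|)%:C.
  by rewrite RRe_real ?normr_real.
rewrite kE -rmorphM; congr (_%:C); apply/le_anti/andP; split.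
  exact: bquot_normZ_le.
have [->|k0] := eqVneq k 0; first by rewrite normr0 mul0r bquot_norm_ge0.
have := bquot_normZ_le k^-1 (k *: q); rewrite scalerA mulVf// scale1r.
have kp : 0 < complex.Re `|k| by rewrite -ltcR -kE normr_gt0.
have -> : complex.Re `|k^-1| = (complex.Re `|k|)^-1.
  by apply: (@complexI R); rewrite -(kE k^-1) normfV {1}(kE k) -fmorphV.
by rewrite ler_pdivlMl.
Qed.

Fact bquot_complete (u : nat -> bquot) :
  (forall e : R, 0 < e -> exists N, forall m n,
      (N <= m)%N -> (N <= n)%N -> bquot_norm (u m - u n) < e) ->
  exists l, forall e : R, 0 < e -> exists N, forall n,
      (N <= n)%N -> bquot_norm (u n - l) < e.
Proof.
move=> uC; pose d k : R := 2^-1 ^+ k.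
have d0 k : 0 < d k by rewrite exprn_gt0// invr_gt0.
have dS k : d k = 2 * d k.+1 by rewrite /d exprS mulrA mulfV ?mul1r.
have /choice [f fP] : forall k, exists N, forall m n,
  (N <= m)%N -> (N <= n)%N -> bquot_norm (u m - u n) < d k by move=> k; exact: uC.
pose g := fix g k := if k is j.+1 then maxn (g j) (f k) else f 0%N.
have gf k : (f k <= g k)%N by case: k => //= k; exact: leq_maxr.
have gS k : (g k <= g k.+1)%N by exact: leq_maxl.
have step k (x : B) : exists y : B, bpi x = u (g k) ->
    bpi y = u (g k.+1) /\ bnorm (y - x) < d k.
  have [xu|nxu] := pselect (bpi x = u (g k)); last by exists x => /nxu.
  have [z zu zd] := bquot_norm_lift (fP k _ _ (leq_trans (gf k) (gS k)) (gf k)).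
  exists (x + z) => _; split; first by rewrite bpiD xu zu addrC subrK.
  by rewrite addrC addKr.
have [x0 x0u] := bpi_surj (u (g 0%N)).
have /choice [F FP] : forall kx : nat * B, exists y : B,
    bpi kx.2 = u (g kx.1) ->
    bpi y = u (g kx.1.+1) /\ bnorm (y - kx.2) < d kx.1.
  by move=> [k x]; exact: step.
pose v := fix v k := if k is j.+1 then F (j, v j) else x0.
have vu k : bpi (v k) = u (g k).
  by elim: k => [//|k IH]; have [] := FP (k, v k) IH.
have vS k : bnorm (v k.+1 - v k) < d k by have [] := FP (k, v k) (vu k).
have vC k n : (k <= n)%N -> bnorm (v n - v k) <= 2 * d k - 2 * d n.
  elim: n => [|n IH]; first by rewrite leqn0 => /eqP ->; rewrite !subrr bnorm0.
  rewrite leq_eqVlt => /predU1P[->|]; first by rewrite !subrr bnorm0.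
  move=> /IH {}IH.
  apply: le_trans (bnormB_tri _ (v n) _) _.
  by have := vS n; have := dS n; move: IH; lra.
have dsmall e : 0 < e -> exists k, d k < e.
  move=> e0; have /cvgrPdist_lt/(_ e e0) : d @ \oo --> (0 : R).
    by apply: cvg_expr; rewrite ger0_norm ?invf_lt1 ?ltr1n.
  case=> k _ kP; exists k; have := kP k (leqnn k).
  by rewrite /= sub0r normrN gtr0_norm.
have [l lP] : exists l, forall e : R, 0 < e -> exists N, forall n,
    (N <= n)%N -> bnorm (v n - l) < e.
  apply: bcomplete => e e0.
  have [k ke] := dsmall (e / 4) (divr_gt0 e0 (ltr0Sn _ _)).
  exists k => m n km kn; apply: le_lt_trans (bnormB_tri _ (v k) _) _.
  rewrite (bnormBC (v k)).
  by have := vC _ _ km; have := vC _ _ kn; have := d0 m; have := d0 n; lra.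
exists (bpi l) => e e0.
have e2 : 0 < e / 2 by lra.
have [k ke] := dsmall _ e2; have [N NP] := lP _ e2.
exists (g k) => n gn.
set j := maxn k N.
have gm a b : (a <= b)%N -> (g a <= g b)%N.
  by elim: b => [|b IH]; [rewrite leqn0 => /eqP ->|
    rewrite leq_eqVlt => /predU1P[->//|/IH/leq_trans]; apply].
have h1 : bquot_norm (u n - u (g j)) < d k.
  apply: fP; first exact: leq_trans (gf k) gn.
  by apply: leq_trans (gf k) _; apply: gm; exact: leq_maxl.
have h2 : bquot_norm (u (g j) - bpi l) < e / 2.
  rewrite -vu -bpiN -bpiD; apply: le_lt_trans (bquot_norm_le _) _.
  by apply: NP; exact: leq_maxr.
have := bquot_normD (u n - u (g j)) (u (g j) - bpi l).
by rewrite addrA subrK; move: h1 h2 ke; lra.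
Qed.

HB.instance Definition _ := isUnitalBanachAlgebra.Build R bquot
  bquot_norm_eq0 bquot_normD bquot_normZ bquot_normM bquot_norm1
  bquot_complete.

End Quotient.

Section Ultraproduct.
Variables (R : realType) (A : nat -> unitalBanachAlgType R).
Variables (U : set_system nat) (hU : UltraFilter U).

Definition cU_set : set (linfty A) :=
  [set a | (fun n => bnorm (a n)) @ U --> (0 : R)].

Lemma cU_setP (a : linfty A) :
  cU_set a <-> forall e : R, 0 < e -> U [set n | bnorm (a n) < e].
Proof.
have aE n (e : R) : `|0 - bnorm (a n)| < e = (bnorm (a n) < e).
  by rewrite sub0r normrN ger0_norm// bnorm_ge0.
split=> [/cvgrPdist_lt aU e e0|aU].
  by apply: filterS (aU e e0) => n /=; rewrite aE.
by apply/cvgrPdist_lt => e e0; apply: filterS (aU e e0) => n /=; rewrite aE.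
Qed.

Fact cU_set0 : cU_set 0.
Proof. by apply/cU_setP => e e0; apply: filterE => n /=; rewrite bnorm0. Qed.

Fact cU_setB a b : cU_set a -> cU_set b -> cU_set (a - b).
Proof.
move=> /cU_setP aU /cU_setP bU; apply/cU_setP => e e0.
have e2 : 0 < e / 2 by lra.
apply: filterS2 (aU _ e2) (bU _ e2) => n /= an bn.
have := bnormD (a n) (- b n); rewrite bnormN.
by move: an bn; lra.
Qed.

Lemma cU_set_le (M : R) (a b : linfty A) :
  (forall n, bnorm (b n) <= M * bnorm (a n)) -> cU_set a -> cU_set b.
Proof.
move=> ab /cU_setP aU; apply/cU_setP => e e0.
have M1 : 0 < `|M| + 1 by rewrite ltr_wpDl.
apply: filterS (aU _ (divr_gt0 e0 M1)) => n /=; rewrite ltr_pdivlMr//.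
apply: le_lt_trans; apply: le_trans (ab n) _; rewrite mulrC.
by rewrite ler_wpM2l ?bnorm_ge0// (le_trans (ler_norm M))// lerDl.
Qed.

Fact cU_setMl a x : cU_set x -> cU_set (a * x).
Proof.
apply: (@cU_set_le (linfty_norm a)) => n /=.
rewrite (le_trans (bnormM _ _))// ler_wpM2r ?bnorm_ge0//.
exact: linfty_norm_ub.
Qed.

Fact cU_setMr a x : cU_set x -> cU_set (x * a).
Proof.
apply: (@cU_set_le (linfty_norm a)) => n /=.
rewrite (le_trans (bnormM _ _))// mulrC ler_wpM2r ?bnorm_ge0//.
exact: linfty_norm_ub.
Qed.

Fact cU_set_proper : ~ cU_set 1.
Proof.
move=> /cU_setP/(_ 1 ltr01) U1; have [n /=] := filter_ex U1.
by rewrite bnorm1 ltxx.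
Qed.

Fact cU_set_closed x :
  (forall e : R, 0 < e -> exists2 y, cU_set y & bnorm (x - y) < e) ->
  cU_set x.
Proof.
move=> xU; apply/cU_setP => e e0; have e2 : 0 < e / 2 by lra.
have [y /cU_setP/(_ _ e2) yU xy] := xU _ e2.
apply: filterS yU => n /= yn.
have := linfty_norm_ub (x - y) n => /=.
have := bnormD (x n - y n) (y n); rewrite subrK.
have -> : linfty_norm (x - y) = bnorm (x - y) by [].
by move: xy yn; lra.
Qed.

Definition cU : closedIdeal (linfty A) :=
  ClosedIdeal cU_set0 cU_setB cU_setMl cU_setMr cU_set_proper cU_set_closed.

Definition ultraproduct : unitalBanachAlgType R := bquot cU.

End Ultraproduct.

Section ProperlyInfinite.
Variable A : pzRingType.
Implicit Types p q : A.

Definition idempotent_elt p : Prop := p * p = p.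

Definition idem_equiv p q : Prop := exists a b : A, p = a * b /\ q = b * a.

Definition idem_orthogonal p q : Prop := p * q = 0 /\ q * p = 0.

Definition properly_infinite : Prop :=
  exists p q : A, [/\ idempotent_elt p, idempotent_elt q, idem_orthogonal p q,
                      idem_equiv p 1 & idem_equiv q 1].

End ProperlyInfinite.

Definition C_PI (R : realType) (A : unitalBanachAlgType R) : \bar R :=
  ereal_inf [set x | exists a b c d : A,
    [/\ a * b = 1, c * d = 1, a * d = 0 & c * b = 0] /\
    x = (bnorm a * bnorm b * bnorm c * bnorm d)%:E].

(* Main.v *)
(* An algebra is properly infinite iff it contains a, b, c, d with
   ab = 1 = cd and ad = 0 = cb.  If these relations hold in the ultraproduct,
   lifts of a, b, c, d to bounded sequences satisfy them approximately on a set
   of U, and an approximate solution can be corrected to an exact one with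
   control of the norms, because elements close to 1 are invertible.
   Conversely, exact solutions a_n, b_n, c_n, d_n whose product of norms is
   bounded can be rescaled so that each of the four sequences is bounded:
   dividing a_n and multiplying b_n by |a_n| gives norms 1 and |a_n||b_n|, and
   |c_n||d_n| >= 1. *)
Require Import Defs.
From mathcomp Require Import all_boot all_order all_algebra.
From mathcomp Require Import all_classical all_reals all_analysis.
From mathcomp Require Import complex lra.

Import Order.TTheory GRing.Theory Num.Theory.
Import numFieldNormedType.Exports.

Local Open Scope classical_set_scope.
Local Open Scope ring_scope.

Definition shift_relations {A : pzRingType} (a b c d : A) : Prop :=
  [/\ a * b = 1, c * d = 1, a * d = 0 & c * b = 0].

(** If [p = b a], [q = d c] and [a b = 1 = c d], then [a = a p] and [d = q d], so
    [a d = a p q d = 0], and symmetrically [c b = 0]. Conversely, [b a] and [d c] are the required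
    idempotents. *)
Lemma properly_infiniteP (A : pzRingType) :
  properly_infinite A <-> exists a b c d : A, shift_relations a b c d.
Proof.
split=> [[p [q [_ _ [pq qp] [b [a [pE ab]]] [d [c [qE cd]]]]]]|].
  exists a, b, c, d; split; rewrite -?ab -?cd//.
  - have -> : a * d = a * (b * a) * (d * c) * d.
      by rewrite !mulrA -ab mul1r -mulrA -cd mulr1.
    by rewrite -pE -qE -(mulrA a) pq mulr0 mul0r.
  - have -> : c * b = c * (d * c) * (b * a) * b.
      by rewrite !mulrA -cd mul1r -mulrA -ab mulr1.
    by rewrite -pE -qE -(mulrA c) qp mulr0 mul0r.
move=> [a [b [c [d [ab cd ad cb]]]]].
have mulA4 (x y z t : A) : x * y * (z * t) = x * (y * z) * t.
  by rewrite !mulrA.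
exists (b * a), (d * c); split.
- by rewrite /idempotent_elt mulA4 ab mulr1.
- by rewrite /idempotent_elt mulA4 cd mulr1.
- by rewrite /idem_orthogonal !mulA4 ad cb !mulr0 !mul0r.
- by exists b, a.
- by exists d, c.
Qed.

Section UnitalBanachAlgebra.
Variables (R : realType) (A : unitalBanachAlgType R).
Implicit Types a b c d u w x : A.

Lemma bnormM_le (M N : R) x y :
  bnorm x <= M -> bnorm y <= N -> bnorm (x * y) <= M * N.
Proof.
move=> xM yN; apply: le_trans (bnormM _ _) _.
by rewrite ler_pM// bnorm_ge0.
Qed.

Lemma bnormB_le (M N : R) x y :
  bnorm x <= M -> bnorm y <= N -> bnorm (x - y) <= M + N.
Proof.
by move=> xM yN; rewrite (le_trans (bnormD _ _))// bnormN lerD.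
Qed.

Lemma half_pow_small (e : R) : 0 < e -> exists k, (2^-1 : R) ^+ k < e.
Proof.
move=> e0.
have /cvgrPdist_lt/(_ e e0) : GRing.exp (2^-1 : R) @ \oo --> (0 : R).
  by apply: cvg_expr; rewrite ger0_norm ?invf_lt1 ?ltr1n.
case=> k _ kP; exists k; have := kP k (leqnn k).
by rewrite /= sub0r normrN gtr0_norm// exprn_gt0.
Qed.

(* The inverse is the limit of the partial sums of the Neumann series of
   [x = 1 - u], which satisfy [s_(n+1) = 1 + x s_n]. *)
Lemma right_inverse_near1 u :
  bnorm (1 - u) <= 2^-1 -> exists2 w, u * w = 1 & bnorm w <= 2.
Proof.
set x := 1 - u => x_le.
pose s := fix s n := if n is k.+1 then 1 + x * s k else 0.
pose h n : R := 2^-1 ^+ n.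
have h_gt0 n : 0 < h n by rewrite exprn_gt0.
have hS n : h n = 2 * h n.+1 by rewrite /h exprS mulrA mulfV ?mul1r.
have s_step n : bnorm (s n.+1 - s n) <= h n.
  elim: n => [|n IHn]; first by rewrite /= mulr0 addr0 subr0 bnorm1.
  have -> : s n.+2 - s n.+1 = x * (s n.+1 - s n).
    by rewrite /= mulrBr opprD addrACA subrr add0r.
  by rewrite /h exprS; exact: bnormM_le.
(* The right-hand side is the geometric sum of [h j] over [k <= j < n], written so that it
   telescopes. *)
have s_dist k n : (k <= n)%N -> bnorm (s n - s k) <= 2 * h k - 2 * h n.
  elim: n => [|n IHn].
    by rewrite leqn0 => /eqP ->; rewrite !subrr bnorm0.
  rewrite leq_eqVlt => /predU1P[->|/IHn {}IHn].
    by rewrite !subrr bnorm0.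
  apply: le_trans (bnormB_tri _ (s n) _) _.
  by have := s_step n; have := hS n; move: IHn; lra.
have [w s_to_w] : exists w, forall e : R, 0 < e -> exists N, forall n,
    (N <= n)%N -> bnorm (s n - w) < e.
  apply: bcomplete => e e0.
  have [k ke] := half_pow_small (e / 4) (divr_gt0 e0 (ltr0Sn _ _)).
  exists k => m n km kn; apply: le_lt_trans (bnormB_tri _ (s k) _) _.
  rewrite (bnormBC (s k)).
  have := s_dist _ _ km; have := s_dist _ _ kn; have := h_gt0 m.
  by have := h_gt0 n; rewrite -/(h k) in ke; lra.
(* The recursion passes to the limit; since [x = 1 - u], this equation says [u w = 1]. *)
have wE : w = 1 + x * w.
  apply/eqP; rewrite -subr_eq0; apply/eqP/bnorm_eq0/le_anti.
  rewrite bnorm_ge0 andbT; apply/ler_addgt0Pr => e e0; rewrite add0r.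
  have e2 : 0 < e / 2 by lra.
  have [N sN] := s_to_w _ e2.
  have sN1 := sN N.+1 (leqnSn N); have {}sN := sN N (leqnn N).
  apply: le_trans (bnormB_tri _ (s N.+1) _) _.
  have -> : s N.+1 - (1 + x * w) = x * (s N - w).
    by rewrite /= mulrBr opprD addrACA subrr add0r.
  have := bnormM_le _ _ _ _ x_le (ltW sN).
  by rewrite bnormBC; move: sN1; lra.
exists w.
  by apply/eqP; rewrite -[u](subKr 1) -/x mulrBl mul1r subr_eq -wE.
(* The same equation gives [|w| <= 1 + |w| / 2], hence [|w| <= 2]. *)
have := bnormD 1 (x * w); rewrite -wE bnorm1.
by have := bnormM_le _ _ _ _ x_le (lexx (bnorm w)); lra.
Qed.

(* First [b] is corrected to have [a b = 1]; then [d - b a d] is annihilated by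
   [a] and is corrected to have [c d = 1]; finally [c] becomes [c - c b a]. *)
Lemma shift_relations_perturb (M : R) a b c d :
  bnorm a <= M -> bnorm b <= M -> bnorm c <= M -> bnorm d <= M ->
  bnorm (a * b - 1) <= 4^-1 -> bnorm (c * d - 1) <= 4^-1 ->
  bnorm (a * d) <= 4^-1 -> bnorm (c * b) <= 4^-1 ->
  exists a' b' c' d', shift_relations a' b' c' d' /\
    bnorm a' * bnorm b' * bnorm c' * bnorm d' <= 16 * M ^+ 4.
Proof.
move=> aM bM cM dM ab1 cd1 ad0 cb0.
have M0 : 0 <= M by apply: le_trans aM; exact: bnorm_ge0.
have [w abw w2] : exists2 w, (a * b) * w = 1 & bnorm w <= 2.
  by apply: right_inverse_near1; rewrite bnormBC; lra.
pose b' := b * w; pose d0 := d - b' * (a * d).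
have ab' : a * b' = 1 by rewrite mulrA.
have cb'_le : bnorm (c * b') <= 4^-1 * 2 by rewrite mulrA; exact: bnormM_le.
have ad0E : a * d0 = 0 by rewrite mulrBr (mulrA a b') ab' mul1r subrr.
(* [c d0 - 1 = (c d - 1) - (c b') (a d)] has norm at most [1/4 + 1/2 * 1/4 = 3/8]. *)
have cd0_near1 : bnorm (1 - c * d0) <= 2^-1.
  rewrite bnormBC mulrBr (mulrA c b') addrAC.
  by have := bnormB_le _ _ _ _ cd1 (bnormM_le _ _ _ _ cb'_le ad0); lra.
have [v cd0v v2] := right_inverse_near1 _ cd0_near1.
pose d' := d0 * v; pose c' := c - c * b' * a.
have ad' : a * d' = 0 by rewrite mulrA ad0E mul0r.
exists a, b', c', d'; split.
  split=> //; first by rewrite mulrBl -(mulrA (c * b')) ad' mulr0 subr0 mulrA.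
  by rewrite mulrBl -(mulrA (c * b')) ab' mulr1 subrr.
have b'M : bnorm b' <= M * 2 by exact: bnormM_le.
have d0M : bnorm d0 <= M * 2.
  by have := bnormB_le _ _ _ _ dM (bnormM_le _ _ _ _ b'M ad0); lra.
have d'M : bnorm d' <= M * 2 * 2 by exact: bnormM_le.
have c'M : bnorm c' <= M * 2.
  by have := bnormB_le _ _ _ _ cM (bnormM_le _ _ _ _ cb'_le aM); lra.
have -> : 16 * M ^+ 4 = M * (M * 2) * (M * 2) * (M * 2 * 2) by lra.
by rewrite !ler_pM ?mulr_ge0 ?bnorm_ge0.
Qed.

Lemma bnorm_normalize a b : a * b = 1 ->
  exists k : R[i], [/\ k != 0, bnorm (k *: a) = 1
    & bnorm (k^-1 *: b) = bnorm a * bnorm b].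
Proof.
move=> ab; have a_neq0 : bnorm a != 0.
  apply: contra_eq_neq ab => /bnorm_eq0 ->.
  by rewrite mul0r eq_sym oner_neq0.
have a_gt0 : 0 < bnorm a by rewrite lt_neqAle eq_sym a_neq0 bnorm_ge0.
have normC (r : R) : 0 <= r -> `|r%:C%C| = r%:C%C.
  by move=> r0; rewrite ger0_norm// ler0c.
exists ((bnorm a)^-1)%:C%C; split.
- by rewrite fmorph_eq0 invr_eq0.
- by rewrite bnormZ_Re normC ?invr_ge0 ?bnorm_ge0//= mulVf.
- by rewrite -fmorphV invrK bnormZ_Re normC ?bnorm_ge0.
Qed.

(** Since [|1| = 1], both [|a| |b|] and [|c| |d|] are at least 1, so each is at most [K]. Mutually
    inverse scalars preserve the relations. *)
Lemma shift_relations_normalize (K : R) a b c d :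
  shift_relations a b c d ->
  bnorm a * bnorm b * bnorm c * bnorm d <= K ->
  exists a' b' c' d', shift_relations a' b' c' d' /\
    [/\ bnorm a' <= K, bnorm b' <= K, bnorm c' <= K & bnorm d' <= K].
Proof.
move=> [ab cd ad cb] normK.
have ab_ge1 : 1 <= bnorm a * bnorm b by rewrite -(@bnorm1 R A) -ab bnormM.
have cd_ge1 : 1 <= bnorm c * bnorm d by rewrite -(@bnorm1 R A) -cd bnormM.
have [k [k0 ka kb]] := bnorm_normalize _ _ ab.
have [l [l0 lc ld]] := bnorm_normalize _ _ cd.
rewrite -mulrA in normK.
have abK : bnorm a * bnorm b <= K.
  by apply: le_trans normK; rewrite ler_peMr// (le_trans ler01).
have cdK : bnorm c * bnorm d <= K.
  by apply: le_trans normK; rewrite ler_peMl// (le_trans ler01).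
exists (k *: a), (k^-1 *: b), (l *: c), (l^-1 *: d); split.
  split; rewrite -scalerAl -scalerAr ?ad ?cb ?scaler0//.
    by rewrite ab scalerA mulfV// scale1r.
  by rewrite cd scalerA mulfV// scale1r.
by rewrite ka kb lc ld; split=> //; exact: le_trans ab_ge1 abK.
Qed.

Lemma C_PI_le (K : R) a b c d : shift_relations a b c d ->
  bnorm a * bnorm b * bnorm c * bnorm d <= K -> (C_PI A <= K%:E)%E.
Proof.
move=> rel normK; apply: le_trans (_ : (_%:E <= _)%E); last first.
  by rewrite lee_fin; exact: normK.
by apply: ereal_inf_lbound; exists a, b, c, d.
Qed.

(** The infimum need not be attained, so the bound assumed on it is strict. *)
Lemma C_PI_lt (K : R) : (C_PI A < K%:E)%E ->
  exists a b c d, shift_relations a b c d /\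
    bnorm a * bnorm b * bnorm c * bnorm d <= K.
Proof.
move=> /ereal_inf_lt[_ [a [b [c [d [rel ->]]]]]].
by rewrite lte_fin => /ltW normK; exists a, b, c, d.
Qed.

End UnitalBanachAlgebra.

Section Ultraproduct.
Variables (R : realType) (A : nat -> unitalBanachAlgType R).
Variables (U : set_system nat) (hU : UltraFilter U).

Local Notation pi := (bpi (cU A hU)).

Lemma ultraproduct_eq_near (x y : linfty A) (e : R) : 0 < e ->
  pi x = pi y -> U [set n | bnorm (x n - y n) <= e].
Proof.
move=> e0 /bpi_eq /cU_setP /(_ e e0).
by apply: filterS => n /= /ltW.
Qed.

(** Membership in the ideal depends only on the coordinates in some set of [U]. *)
Lemma ultraproduct_eq (x y : linfty A) :
  U [set n | x n = y n] -> pi x = pi y.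
Proof.
move=> xy; apply/bpi_eq/cU_setP => e e0; apply: filterS xy => n /= ->.
by rewrite subrr bnorm0.
Qed.

End Ultraproduct.

Theorem theorem4p19 (R : realType) (A : nat -> unitalBanachAlgType R)
    (U : set_system nat) (hU : UltraFilter U)
    (U_nonprincipal : forall n : nat, U <> principal_filter n) :
  properly_infinite (ultraproduct A hU) <->
  exists K : R, 0 < K /\ U [set n | (C_PI (A n) <= K%:E)%E].
Proof.
rewrite properly_infiniteP; split.
  move=> [a0 [b0 [c0 [d0]]]].
  have [a <-] := bpi_surj a0; have [b <-] := bpi_surj b0.
  have [c <-] := bpi_surj c0; have [d <-] := bpi_surj d0.
  (* This is the tolerance of [shift_relations_perturb]. *)
  have e0 : 0 < 4^-1 :> R by [].
  rewrite /shift_relations -!bpiM -!bpi1 -!bpi0.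
  move=> [/(ultraproduct_eq_near _ _ _ _ _ _ _ e0) ab
          /(ultraproduct_eq_near _ _ _ _ _ _ _ e0) cd
          /(ultraproduct_eq_near _ _ _ _ _ _ _ e0) ad
          /(ultraproduct_eq_near _ _ _ _ _ _ _ e0) cb].
  pose M := 1 + bnorm a + bnorm b + bnorm c + bnorm d.
  have [an bn cn dn] :
      [/\ 0 <= bnorm a, 0 <= bnorm b, 0 <= bnorm c & 0 <= bnorm d].
    by split; exact: bnorm_ge0.
  have M0 : 0 < M by rewrite /M; lra.
  exists (16 * M ^+ 4); split; first by rewrite mulr_gt0// exprn_gt0.
  apply: filterS2 (filterI ab cd) (filterI ad cb) => n /=.
  rewrite !subr0 => -[abn cdn] [adn cbn].
  have le_M (x : linfty A) : bnorm x <= M -> bnorm (x n) <= M.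
    by apply: le_trans; exact: linfty_norm_ub.
  have [||||a' [b' [c' [d' [rel normK]]]]] := @shift_relations_perturb
    _ _ M _ _ _ _ _ _ _ _ abn cdn adn cbn; last exact: C_PI_le rel normK.
  - by apply: le_M; rewrite /M; lra.
  - by apply: le_M; rewrite /M; lra.
  - by apply: le_M; rewrite /M; lra.
  - by apply: le_M; rewrite /M; lra.
move=> [K [K0 UK]].
(* The norm bounds are required at every [n], so that the chosen sequences lie in [linfty]; where
   [C_PI] exceeds [K], zeros serve as default. The bound [K + 1] makes the inequality on [C_PI]
   strict. *)
have solutions n : {t : A n * A n * (A n * A n) |
    ((C_PI (A n) <= K%:E)%E ->
      shift_relations t.1.1 t.1.2 t.2.1 t.2.2) /\
    [/\ bnorm t.1.1 <= K + 1, bnorm t.1.2 <= K + 1,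
        bnorm t.2.1 <= K + 1 & bnorm t.2.2 <= K + 1]}.
  apply: cid; have [nK|nK] := pselect (C_PI (A n) <= K%:E)%E; last first.
    by exists (0, 0, (0, 0)); split=> //=; rewrite bnorm0; split; lra.
  have /C_PI_lt[a [b [c [d [rel normK]]]]] : (C_PI (A n) < (K + 1)%:E)%E.
    by apply: le_lt_trans nK _; rewrite lte_fin; lra.
  have [a' [b' [c' [d' [rel' norms]]]]] :=
    shift_relations_normalize _ _ _ _ _ _ _ rel normK.
  by exists (a', b', (c', d')).
pose f n := sval (solutions n); have fP n := svalP (solutions n).
pose seqL (g : forall n, A n) (gK : forall n, bnorm (g n) <= K + 1) :=
  Linfty (ex_intro _ (K + 1) gK).
have aK n : bnorm (f n).1.1 <= K + 1 by case: (fP n) => _ [].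
have bK n : bnorm (f n).1.2 <= K + 1 by case: (fP n) => _ [].
have cK n : bnorm (f n).2.1 <= K + 1 by case: (fP n) => _ [].
have dK n : bnorm (f n).2.2 <= K + 1 by case: (fP n) => _ [].
exists (bpi (cU A hU) (seqL _ aK)), (bpi (cU A hU) (seqL _ bK)).
exists (bpi (cU A hU) (seqL _ cK)), (bpi (cU A hU) (seqL _ dK)).
rewrite /shift_relations -!bpiM -!bpi1 -!bpi0.
by split; apply: ultraproduct_eq; apply: filterS UK => n /= nK;
  case: (fP n) => /(_ nK) [].
Qed.
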